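(* Let $k,\ell\ge 2$ be integers. Define the sequence $(\widetilde{C}_n)_{n\ge 0}=(\widetilde{C}_n^{(k,\ell)})_{n\ge0}$ by the initial values $\widetilde{C}_0=1$, $\widetilde{C}_1=\cdots=\widetilde{C}_{k-1}=0$, $\widetilde{C}_k=\cdots=\widetilde{C}_{k+\ell-2}=1$, and, for all $n\ge k+\ell-1$, the recurrence $$\widetilde{C}_n=\widetilde{C}_{n-\ell}+\widetilde{C}_{n-\ell-1}+\cdots+\widetilde{C}_{n-k-\ell+1}.$$ Let $\widetilde{A}_{0,k,\ell}$ be the $(k+\ell-1)\times(k+\ell-1)$ matrix whose $(i,1)$ entry is $\widetilde{C}_{i-1}$ and whose $(i,m)$ entry for $2\le m\le k+\ell-1$ is $\widetilde{C}_{i+\ell+m-3}$ ($1\le i\le k+\ell-1$); that is, $$\widetilde{A}_{0,k,\ell}=\begin{pmatrix} \widetilde{C}_0 & \widetilde{C}_{\ell} & \widetilde{C}_{\ell+1} & \cdots & \widetilde{C}_{k+2\ell-3}\\ \widetilde{C}_1 & \widetilde{C}_{\ell+1} & \widetilde{C}_{\ell+2} & \cdots & \widetilde{C}_{k+2\ell-2}\\ \vdots & \vdots & \vdots & \ddots & \vdots\\ \widetilde{C}_{k+\ell-2} & \widetilde{C}_{k+2\ell-2} & \widetilde{C}_{k+2\ell-1} & \cdots & \widetilde{C}_{2k+3\ell-5} \end{pmatrix}.$$ Then $$\det(\widetilde{A}_{0,k,\ell})=\begin{cases} (-1)^{\frac{(k+\ell)(k+\ell-1)}{2}+1}, & \text{if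 } \ell-1=\alpha k \text{ for some integer } \alpha \text{ and } \gcd(\ell,k-1)=1;\\ (-1)^{\frac{(k+\ell)(k+\ell-1)}{2}}, & \text{if } \ell-2=\beta k \text{ for some integer } \beta \text{ and } \gcd(\ell,k-1)=1;\\ 0, & \text{otherwise}. \end{cases}$$ *)

(* Defs.v *)
From mathcomp Require Import all_boot all_order all_algebra.

Set Implicit Arguments.
Unset Strict Implicit.
Unset Printing Implicit Defensive.

Import GRing.Theory.
Local Open Scope ring_scope.

(* [fuel] bounds the recursion depth; any [fuel > n] gives the same value when
   [0 < l] (see [Ctilde_rec]). *)
Fixpoint Ctilde_fuel (k l fuel n : nat) : int :=
  if fuel is fuel'.+1 then
    if n == 0%N then 1
    else if (n < k)%N then 0
    else if (n < (k + l).-1)%N then 1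
    else \sum_(l <= j < k + l) Ctilde_fuel k l fuel' (n - j)
  else 0.

Definition Ctilde (k l n : nat) : int := Ctilde_fuel k l n.+1 n.

Lemma Ctilde0 (k l : nat) : Ctilde k l 0 = 1.
Proof. by []. Qed.

Lemma Ctilde_zeros (k l n : nat) : (0 < n < k)%N -> Ctilde k l n = 0.
Proof. by rewrite /Ctilde /=; case: n => [|n] //= ->. Qed.

Lemma Ctilde_ones (k l n : nat) :
  (0 < k)%N -> (k <= n < (k + l).-1)%N -> Ctilde k l n = 1.
Proof.
move=> k0 /andP[kn nkl]; rewrite /Ctilde /= nkl [(n < k)%N]ltnNge kn /=.
by rewrite eqn0Ngt (leq_trans k0 kn).
Qed.

Lemma Ctilde_fuelE (k l fuel n : nat) :
  (0 < l)%N -> (n < fuel)%N -> Ctilde_fuel k l fuel n = Ctilde k l n.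
Proof.
move=> l0; rewrite /Ctilde.
have: (n < n.+1)%N by [].
move: {2 4}n.+1 => g; elim: fuel g n => // f IH [|g] n //=.
rewrite !ltnS => ng nf; case: eqP => // /eqP n0; case: ifP => // _.
case: ifP => // _; apply: eq_big_nat => j /andP[lj _].
have nj : (n - j < n)%N.
  by rewrite ltn_subrL (leq_trans l0 lj) lt0n n0.
by apply: IH; [exact: leq_trans nj ng | exact: leq_trans nj nf].
Qed.

Lemma Ctilde_rec (k l n : nat) : (0 < k)%N -> (1 < l)%N ->
  ((k + l).-1 <= n)%N ->
  Ctilde k l n = \sum_(l <= j < k + l) Ctilde k l (n - j).
Proof.
move=> k0 l1 kln.
have kn : (k <= n)%N.
  by apply: leq_trans kln; case: l l1 => // l l1; rewrite addnS leq_addr.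
have n0 : (0 < n)%N by exact: leq_trans kn.
rewrite {1}/Ctilde /= eqn0Ngt n0 /= ltnNge kn /= ltnNge kln /=.
apply: eq_big_nat => j /andP[lj _]; apply: Ctilde_fuelE; first exact: ltnW.
by rewrite ltn_subrL n0 (leq_trans _ lj) // ltnW.
Qed.

(* Indices are 0-based: with [i, m] the 1-based row and column indices, the
   subscript [i + l + m - 3] becomes [(i + l + j).-1]. *)
Definition Atilde0 (k l : nat) : 'M[int]_((k + l).-1) :=
  \matrix_(i < (k + l).-1, j < (k + l).-1)
    if (j : nat) == 0%N then Ctilde k l i else Ctilde k l (i + l + j).-1.

(* Main.v *)
(* Let [C] be the companion matrix of f = X^N - (1 + ... + X^(k-1)), N = k+l-1,
   and w = (C~_0, ..., C~_(N-1))^T.  The columns of A~_0 are w, C^l w, ...,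
   C^(l+N-2) w.  Let e be the last unit vector.  The initial values amount to
   C w = (1 + C + ... + C^(l-1)) e, so, with y = C^(-l) e,
     C A~_0 = (1 + C + ... + C^(l-1)) C^l [y, e, C e, ..., C^(N-2) e].
   The bracket has determinant y_0 times a sign, and y_0 = [k | l-1] - [k | l-2]
   because -1/f = (1-x)/(1-x^k) modulo x^(k+l-1).  The determinant of
   1 + C + ... + C^(l-1) is, up to sign, the product of f(z) over the l-th roots
   of unity z <> 1, where f(z) = (1 - z^(k-1))/(z - 1); it is [gcd(l, k-1) = 1]
   up to sign, as raising to the power k-1 permutes these z in the coprime case. *)

Require Import Defs.
From mathcomp Require Import all_boot all_order all_algebra.
From mathcomp Require Import all_field zify ring.

Set Implicit Arguments.
Unset Strict Implicit.
Unset Printing Implicit Defensive.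

Import GRing.Theory Num.Theory.
Local Open Scope ring_scope.

(** Expansion along the first row leaves only its last entry, with sign (-1)^n, and C(n+1,2) = n +
    C(n,2). *)
Lemma det_antitrig (R : comPzRingType) (n : nat) (A : 'M[R]_n) :
  (forall i j : 'I_n, (i + j.+1 < n)%N -> A i j = 0) ->
  (forall i j : 'I_n, (i + j.+1)%N = n -> A i j = 1) ->
  \det A = (-1) ^+ 'C(n, 2).
Proof.
elim: n A => [|n IHn] A A0 A1; first by rewrite det_mx00.
rewrite (expand_det_row _ ord0) big_ord_recr /= big1 => [|j _]; last first.
  by rewrite A0 ?mul0r //= add0n ltnS ltn_ord.
rewrite add0r A1 // mul1r /cofactor /= add0n IHn => [|i j hij|i j hij].
- by rewrite binS bin1 exprD mulrC.
- by rewrite !mxE A0 // !lift0 lift_max addSn ltnS.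
- by rewrite !mxE A1 // !lift0 lift_max addSn hij.
Qed.

(** * Companion matrices: characteristic polynomial and determinants *)

Definition recmx (R : pzRingType) (n k : nat) : 'M[R]_n.+1 :=
  \matrix_(i, j) if i == n :> nat then (j < k)%:R else (i.+1 == j :> nat)%:R.

Lemma map_recmx (aR rR : pzRingType) (f : {rmorphism aR -> rR}) (n k : nat) :
  map_mx f (recmx aR n k) = recmx rR n k.
Proof. by apply/matrixP => i j; rewrite !mxE; case: ifP; rewrite rmorph_nat. Qed.

Lemma char_poly_recmx (R : comNzRingType) (n k : nat) : (k <= n.+1)%N ->
  char_poly (recmx R n k) = 'X^(n.+1) - \poly_(j < k) 1.
Proof.
move=> kn; set q := \poly_(j < k) _; set p := _ - q.
have hsz : (size q <= n.+1)%N.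
  exact: leq_trans (size_poly _ _) kn.
have sp : size p = n.+2 by rewrite size_polyDl size_polyXn // size_polyN ltnS.
have mp : p \is monic.
  by rewrite monicE lead_coefDl ?lead_coefXn // size_polyXn size_polyN ltnS.
rewrite -[RHS](companionmxK mp).
have pE (j : 'I_n.+1) : - p`_j = (j < k)%:R.
  rewrite coefB coefXn coef_poly ltn_eqF // sub0r opprK.
  by case: ltnP.
have: recmx R n k = \matrix_(i, j)
    if i == n :> nat then - p`_j else (i.+1 == j :> nat)%:R.
  by apply/matrixP => i j; rewrite !mxE pE.
(* The dimension of [companionmx p] involves [size p]; with the entries unfolded, [sp] rewrites the
   type and the entries at once. *)
have -> : companionmx p = \matrix_(i, j)
    if i == (size p).-2 :> nat then - p`_j else (i.+1 == j :> nat)%:R by [].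
by rewrite sp => ->.
Qed.

Lemma det_recmx_sub (R : comNzRingType) (n k : nat) (z : R) : (k <= n.+1)%N ->
  \det (recmx R n k - z%:M) = (-1) ^+ n.+1 * (z ^+ n.+1 - \sum_(j < k) z ^+ j).
Proof.
move=> kn; have := congr1 (horner_eval z) (char_poly_recmx R kn).
rewrite /char_poly /char_poly_mx -det_map_mx /= !horner_evalE.
rewrite hornerD hornerN hornerXn horner_poly => h.
under eq_bigr => j _ do rewrite -[z ^+ j]mul1r.
rewrite -h -detZ; congr (\det _); apply/matrixP => i j; rewrite !mxE.
by rewrite !horner_evalE !hornerE; case: (i == j); rewrite ?mulr0n ?mulr1n ?hornerE; ring.
Qed.

Lemma det_recmx (R : comNzRingType) (n k : nat) : (0 < k <= n.+1)%N ->
  \det (recmx R n k) = (-1) ^+ n.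
Proof.
case: k => // k kn.
have := det_recmx_sub (0 : R) kn.
have -> : (0 : R)%:M = 0 :> 'M_n.+1 by apply/matrixP => i j; rewrite !mxE mul0rn.
rewrite subr0 => ->.
rewrite big_ord_recl big1 => [|j _]; last by rewrite /= expr0n.
by rewrite expr0n expr0 sub0r addr0 exprS; ring.
Qed.

(** * Action of the companion matrix on windows of a sequence *)

Definition colseq (R : Type) (n : nat) (s : nat -> R) : 'cV[R]_n.+1 := \col_i s i.

Lemma mul_recmx_ltn (R : pzRingType) (n k : nat) (v : 'cV[R]_n.+1) (i : 'I_n.+1) :
  (i < n)%N -> (recmx R n k *m v) i ord0 = v (inord i.+1) ord0.
Proof.
move=> lt_in; rewrite mxE (bigD1 (inord i.+1)) //= big1 => [|j nj].
  by rewrite mxE ltn_eqF // inordK // eqxx mul1r addr0.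
rewrite mxE ltn_eqF //; case: eqP => [e|_]; last by rewrite mul0r.
by case/eqP: nj; apply: val_inj; rewrite /= inordK.
Qed.

Lemma exp_recmx_ltn (R : pzRingType) (n k m : nat) (v : 'cV[R]_n.+1) (i : 'I_n.+1) :
  (i + m < n.+1)%N -> (recmx R n k ^+ m *m v) i ord0 = v (inord (i + m)) ord0.
Proof.
elim: m i => [|m IHm] i him; first by rewrite expr0 mul1mx addn0 inord_val.
have lt_in : (i < n)%N by lia.
rewrite exprS -mulmxA mul_recmx_ltn // IHm inordK //; last by lia.
by rewrite addSnnS.
Qed.

Lemma mul_recmx_colseq (R : pzRingType) (n k : nat) (s : nat -> R) :
  (k <= n.+1)%N -> s n.+1 = \sum_(j < k) s j ->
  recmx R n k *m colseq n s = colseq n (fun i => s i.+1).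
Proof.
move=> kn hs; apply/colP => i; case: (ltnP i n) => hi.
  by rewrite mul_recmx_ltn // !mxE inordK.
have -> : i = ord_max by apply: val_inj => /=; have := ltn_ord i; lia.
rewrite !mxE /= hs (big_ord_widen _ _ kn) [RHS]big_mkcond /=.
by apply: eq_bigr => j _; rewrite !mxE eqxx; case: ifP; rewrite ?mul1r ?mul0r.
Qed.

(** The recurrence is asked for only at p < m, since [backseq] satisfies it only on an initial
    range. *)
Lemma exp_recmx_colseq (R : pzRingType) (n k m : nat) (s : nat -> R) :
  (k <= n.+1)%N ->
  (forall p, (p < m)%N -> s (p + n.+1)%N = \sum_(j < k) s (p + j)%N) ->
  recmx R n k ^+ m *m colseq n s = colseq n (fun i => s (m + i)%N).
Proof.
move=> kn; elim: m => [|m IHm] hs; first by rewrite expr0 mul1mx.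
rewrite exprS -mulmxA IHm => [|p hp]; last by rewrite hs // ltnW.
rewrite mul_recmx_colseq ?hs //; apply/colP => i; rewrite !mxE.
by rewrite addSnnS.
Qed.

(** * Roots of unity and the determinant of the geometric sum *)

Lemma prod_prim_root (F : fieldType) (l : nat) (z : F) :
  l.+1.-primitive_root z ->
  \prod_(i < l) ('X - (z ^+ i.+1)%:P) = \sum_(j < l.+1) 'X^j.
Proof.
move=> pz; apply: (@mulfI _ ('X - 1%:P)); first by rewrite polyXsubC_eq0.
rewrite -subrX1 -(factor_Xn_sub_1 pz) big_mkord big_ord_recl expr0.
by [].
Qed.

Lemma prod_one_sub_prim_root (F : fieldType) (l : nat) (z : F) :
  l.+1.-primitive_root z -> \prod_(i < l) (1 - z ^+ i.+1) = l.+1%:R.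
Proof.
move=> pz; have := congr1 (horner_eval 1) (prod_prim_root pz).
rewrite rmorph_prod rmorph_sum /=.
under eq_bigr do rewrite horner_evalE hornerXsubC.
move=> ->; under eq_bigr do rewrite horner_evalE hornerXn expr1n.
by rewrite sumr_const card_ord.
Qed.

Lemma det_geometric_recmx (k l : nat) :
  \det (\sum_(j < l.+2) recmx int (k + l.+2) k.+2 ^+ j) =
    (-1) ^+ ((k + l.+2) * l.+1) * (coprime l.+2 k.+1)%:R.
Proof.
set n := (k + l.+2)%N; have kn : (k.+2 <= n.+1)%N by rewrite /n; lia.
have [z pz] := C_prim_root_exists (ltn0Sn l.+1).
apply: (@intr_inj algC); rewrite -det_map_mx raddf_sum /=.
under eq_bigr do rewrite rmorphXn /= map_recmx.
set C := recmx _ _ _.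
have -> : \sum_(j < l.+2) C ^+ j = \prod_(i < l.+1) (C - (z ^+ i.+1)%:M).
  transitivity (horner_mx C (\sum_(j < l.+2) 'X^j)).
    by rewrite rmorph_sum; apply: eq_bigr => j _; rewrite rmorphXn /= horner_mx_X.
  rewrite -(prod_prim_root pz) rmorph_prod; apply: eq_bigr => i _.
  by rewrite rmorphB /= horner_mx_X horner_mx_C.
have -> : \det (\prod_(i < l.+1) (C - (z ^+ i.+1)%:M)) =
          \prod_(i < l.+1) \det (C - (z ^+ i.+1)%:M).
  by apply: (big_morph (fun M : 'M_n.+1 => \det M)) => [A B|]; rewrite ?det_mulmx ?det1.
have step x : x ^+ l.+2 = 1 ->
    \det (C - x%:M) * (1 - x) = (-1) ^+ n * (1 - x ^+ k.+1).
  move=> xl; rewrite det_recmx_sub //.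
  have -> : x ^+ n.+1 = x ^+ k.+1 by rewrite /n -addSn exprD xl mulr1.
  transitivity ((-1) ^+ n *
    ((x - 1) * x ^+ k.+1 - (x - 1) * \sum_(j < k.+2) x ^+ j)).
    by rewrite exprS; ring.
  by rewrite -[X in _ - X]subrX1 [x ^+ k.+2]exprS; ring.
have l0 : l.+2%:R != 0 :> algC by rewrite pnatr_eq0.
(* Multiplying by [l.+2], the product of all 1 - z^(i+1), supplies the factors 1 - x that [step]
   requires. *)
apply: (mulIf l0); rewrite -{1}(prod_one_sub_prim_root pz) -big_split /=.
under eq_bigr => i _.
  rewrite step; last by rewrite exprAC (prim_expr_order pz) expr1n.
  rewrite exprAC; over.
rewrite big_split /= prodr_const card_ord -exprM intrM rmorphXn /= rmorphN1.
rewrite -mulrA; congr (_ * _).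
have [co|nco] := boolP (coprime l.+2 k.+1).
  (* In the coprime case z^(k+1) is again a primitive root, so the same product reappears. *)
  rewrite mul1r prod_one_sub_prim_root //.
  by rewrite (prim_root_exp_coprime _ pz) coprime_sym.
rewrite mul0r; set d := gcdn l.+2 k.+1.
have d1 : (1 < d)%N.
  by rewrite ltn_neqAle eq_sym nco gcdn_gt0.
(* With q = (l+2)/d < l+2, the factor 1 - z^(q(k+1)) vanishes because l+2 divides q(k+1). *)
have [q lq] := dvdnP (dvdn_gcdl l.+2 k.+1); rewrite -/d in lq.
have q0 : (0 < q)%N by case: q lq.
have ql : (q.-1 < l.+1)%N by nia.
rewrite (bigD1 (Ordinal ql)) //= prednK // -exprM.
have [r ->] := dvdnP (dvdn_gcdr l.+2 k.+1); rewrite -/d.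
by rewrite -mulnA [(d * q)%N]mulnC -lq mulnC exprM (prim_expr_order pz) expr1n subrr mul0r.
Qed.

Lemma det_exp (R : comPzRingType) (n m : nat) (A : 'M[R]_n.+1) :
  \det (A ^+ m) = (\det A) ^+ m.
Proof.
elim: m => [|m IHm]; first by rewrite !expr0 det1.
by rewrite !exprS -mulmxE det_mulmx IHm.
Qed.

(** * Extending the unit vector backwards along the recurrence *)

Lemma sum_dvd_window (R : pzSemiRingType) (k a m : nat) : (0 < k)%N ->
  \sum_(j < k) ((m + j <= a)%N && (k %| a - (m + j))%N)%:R = (m <= a)%N%:R :> R.
Proof.
move=> k0; have [ma|am] := leqP m a; last first.
  by apply: big1 => j _; case: leqP => //=; lia.
(* This remainder is the only j < k with m + j congruent to a modulo k. *)
have jk : ((a - m) %% k < k)%N by rewrite ltn_mod.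
have ja : ((a - m) %% k <= a - m)%N by exact: leq_mod.
rewrite (bigD1 (Ordinal jk)) //= big1 => [|j nj].
  rewrite addr0 subnDA -eqn_mod_dvd // modn_mod eqxx andbT.
  by have -> : (m + (a - m) %% k <= a)%N by lia.
have -> : (m + j <= a)%N && (k %| a - (m + j))%N = false; last by [].
apply/negbTE; apply: contra nj => /andP[mja].
rewrite subnDA -eqn_mod_dvd; last by lia.
by rewrite (modn_small (ltn_ord j)) => /eqP e; apply/eqP/val_inj.
Qed.

(* Parameters [k], [l] stand for k+2, l+2.  Position [k + l.+2 + l.+2] carries the
   entry 1 of the unit vector e, and the terms below [l.+2] are the coefficients
   of -1/f at 0 in reverse order. *)
Definition backseq (k l n : nat) : int :=
  ((n <= l.+1) && (k.+2 %| l.+1 - n))%N%:R - ((n <= l) && (k.+2 %| l - n))%N%:R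
  + (n == k + l.+2 + l.+2)%N%:R.

Lemma backseq_large (k l n : nat) : (l.+2 <= n)%N ->
  backseq k l n = (n == k + l.+2 + l.+2)%N%:R.
Proof.
move=> ln; rewrite /backseq [(n <= l.+1)%N]leqNgt ln [(n <= l)%N]leqNgt.
by rewrite (ltnW ln) /= subrr add0r.
Qed.

(** The two divisibility terms sum to [m <= l+1] - [m <= l] = [m = l+1], exactly when the left side
    hits the entry 1. The bound on m keeps that entry out of the window on the right. *)
Lemma backseq_rec (k l m : nat) : (m < l.+2 + l.+1)%N ->
  backseq k l (m + (k + l.+2).+1) = \sum_(j < k.+2) backseq k l (m + j).
Proof.
move=> hm; rewrite backseq_large; last by lia.
rewrite /backseq big_split sumrB /= !sum_dvd_window //.
rewrite [X in _ + X]big1 => [|j _]; last first.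
  by have := ltn_ord j; case: eqP => //; lia.
have -> : (m + (k + l.+2).+1 == k + l.+2 + l.+2)%N = (m == l.+1) by lia.
by case: (ltngtP m l.+1) => hml; rewrite ?ltnS;
  case: (leqP m l) => //; lia.
Qed.

Lemma Ctilde_rec_ord (k l m : nat) :
  Ctilde k.+2 l.+2 (m + (k + l.+2).+1) =
  \sum_(j < k.+2) Ctilde k.+2 l.+2 (m + j).
Proof.
rewrite Ctilde_rec //; last by rewrite !addSn /=; lia.
rewrite -{1}[l.+2]add0n big_addn addnK big_mkord (reindex_inj rev_ord_inj) /=.
by apply: eq_bigr => j _; congr Ctilde; have := ltn_ord j; lia.
Qed.

(** These are the entries of C w. The last one lies just past the initial values: the recurrence
    gives it, with [Ctilde] at 0 as the only nonzero term. *)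
Lemma Ctilde_init (k l i : nat) : (i <= k + l.+2)%N ->
  Ctilde k.+2 l.+2 i.+1 = (k < i)%N%:R.
Proof.
move=> hi; have [ik|ki] := leqP i k; first by rewrite Ctilde_zeros.
have [lin|] := ltnP i (k + l.+2); first by rewrite Ctilde_ones // !addSn /=; lia.
move=> ni; have -> : i = (k + l.+2)%N by lia.
rewrite -[(k + l.+2).+1]add0n Ctilde_rec_ord big_ord_recl big1 ?addr0 // => j _.
by rewrite add0n lift0 Ctilde_zeros //=; have := ltn_ord j; lia.
Qed.

(** * Factorisation of the matrix and its determinant *)

Section Factorisation.

Variables k l : nat.
Let n := (k + l.+2)%N.
Let C := recmx int n k.+2.
Let w := colseq n (Ctilde k.+2 l.+2).
Let y := colseq n (backseq k l).
Let eps := C ^+ l.+2 *m y.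
Let G := \sum_(j < l.+2) C ^+ j.
Let kn : (k.+2 <= n.+1)%N. Proof. by rewrite /n; lia. Qed.
Let mulmx_exp a b : C ^+ a *m C ^+ b = C ^+ (a + b).
Proof. by rewrite mulmxE -exprD. Qed.

Lemma exp_mul_backseq j : (j < l.+2)%N ->
  C ^+ j *m eps = colseq n (fun i => backseq k l (j + l.+2 + i)%N).
Proof.
move=> hj; rewrite /eps mulmxA mulmx_exp exp_recmx_colseq // => p hp.
by apply: backseq_rec; lia.
Qed.

(** Defining [eps] from [y] avoids inverting C; this identifies it with the unit vector e of the
    overview. *)
Lemma last_unitE (i : 'I_n.+1) : eps i ord0 = (i == n :> nat)%:R.
Proof.
have -> : eps = C ^+ 0 *m eps by rewrite expr0 mul1mx.
rewrite exp_mul_backseq // mxE backseq_large; last by lia.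
by congr (_%:R); rewrite /n; lia.
Qed.

(** For j <= l+1, C^j e has entry 1 at i exactly when i + j = n. Hence G e has entry 1 at i exactly
    when n - i <= l+1, that is, when k < i. *)
Lemma mul_recmx_Ctilde : C *m w = G *m eps.
Proof.
rewrite mulmx_suml mul_recmx_colseq //; last exact: (Ctilde_rec_ord k l 0).
apply/colP => i; rewrite mxE summxE Ctilde_init; last by rewrite -ltnS.
rewrite (eq_bigr (fun j : 'I_l.+2 => (j + l.+2 + i == n + l.+2)%N%:R)); last first.
  by move=> j _; rewrite exp_mul_backseq // mxE backseq_large //; lia.
have hi : (i <= n)%N by rewrite -ltnS.
have [ik|ki] := ltnP k i; last first.
  rewrite big1 // => j _; have hj := ltn_ord j.
  case: eqP => // e; exfalso; move: hj ki e; rewrite /n.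
  by move: (nat_of_ord j) (nat_of_ord i) => a b; lia.
have nl : (n - i < l.+2)%N.
  by move: ik; rewrite /n; move: (nat_of_ord i) => a; lia.
rewrite (bigD1 (Ordinal nl)) //= big1 => [|j nj].
  by have -> : (n - i + l.+2 + i == n + l.+2)%N by lia.
by case: eqP => // e; case/eqP: nj; apply: val_inj => /=; lia.
Qed.

Let reduced : 'M[int]_n.+1 := \matrix_(i, j)
  if (j : nat) == 0%N then y i ord0 else (C ^+ j.-1 *m eps) i ord0.

Lemma reduced_antitrig (i j : 'I_n.+1) : (0 < j)%N -> (i + j <= n.+1)%N ->
  reduced i j = (i + j == n.+1)%N%:R.
Proof.
rewrite mxE; case: (nat_of_ord j) => // m _ hij /=.
have him : (i + m < n.+1)%N by rewrite -addnS.
by rewrite exp_recmx_ltn // last_unitE inordK // addnS eqSS.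
Qed.

(** The first row vanishes after its entry y_0, and the complementary minor is antitriangular of
    size n. *)
Lemma det_reduced : \det reduced = backseq k l 0 * (-1) ^+ 'C(n, 2).
Proof.
rewrite (expand_det_row _ ord0) big_ord_recl big1 ?addr0 => [|j _]; last first.
  have hj := ltn_ord j; rewrite reduced_antitrig ?lift0 ?add0n //; last exact: ltnW.
  by rewrite eqSS ltn_eqF ?mul0r.
rewrite !mxE /= /cofactor expr0 mul1r; congr (_ * _).
apply: det_antitrig => i j hij; rewrite 2!mxE reduced_antitrig ?lift0 // addSn.
- by rewrite eqSS ltn_eqF.
- exact: ltnW.
- by rewrite hij eqxx.
- by rewrite hij.
Qed.

Lemma Atilde0_factor : C *m Atilde0 k.+2 l.+2 = G *m C ^+ l.+2 *m reduced.
Proof.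
(* Both matrices have the same column exponents, applied to w and to [eps]: the first column [y] of
   [reduced] becomes [eps] under C^(l+2). *)
pose e (j : 'I_n.+1) := if (j : nat) == 0%N then 0%N else (l.+2 + j.-1)%N.
have colA j : col j (Atilde0 k.+2 l.+2) = C ^+ e j *m w.
  rewrite exp_recmx_colseq // => [|p _]; last exact: Ctilde_rec_ord.
  apply/colP => i; rewrite !mxE /e; case: (nat_of_ord j) => //= m.
  by rewrite addnS -addnA addnC.
have colD j : C ^+ l.+2 *m col j reduced = C ^+ e j *m eps.
  have -> : col j reduced = if (j : nat) == 0%N then y else C ^+ j.-1 *m eps.
    by apply/colP => i; rewrite !mxE; case: ifP; rewrite ?mxE.
  rewrite /e; case: ifP => _; first by rewrite expr0 mul1mx.
  by rewrite mulmxA mulmx_exp.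
have GC j : GRing.comm G (C ^+ e j).
  by apply: commr_sym; apply: commr_sum => i _; apply: commrX; apply: commr_sym; apply: commrX.
have eq_col j : col j (C *m Atilde0 k.+2 l.+2) = col j (G *m C ^+ l.+2 *m reduced).
  transitivity (C *m (C ^+ e j *m w)); first by rewrite -colA !colE mulmxA.
  transitivity (G *m (C ^+ e j *m eps)); last by rewrite -colD !colE !mulmxA.
  rewrite mulmxA.
  have -> : C *m C ^+ e j = C ^+ e j *m C by rewrite -[LHS]exprS exprSr.
  rewrite -mulmxA mul_recmx_Ctilde (mulmxA (C ^+ e j) G) (mulmxA G).
  congr (_ *m _). exact: (esym (GC j)).
by apply/matrixP => i j; have /colP/(_ i) := eq_col j; rewrite !mxE.
Qed.

Lemma det_Atilde0 : \det (Atilde0 k.+2 l.+2) =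
  (coprime l.+2 k.+1)%:R * ((k.+2 %| l.+1)%N%:R - (k.+2 %| l)%N%:R) * (-1) ^+ 'C(n, 2).
Proof.
have := congr1 determinant Atilde0_factor.
rewrite 3!det_mulmx det_reduced det_geometric_recmx -/n.
rewrite det_exp det_recmx; last by rewrite kn.
have -> : backseq k l 0 = (k.+2 %| l.+1)%N%:R - (k.+2 %| l)%N%:R.
  by rewrite /backseq !subn0 addnS addr0.
set s := (_ - _ : int) => eqA; apply: (mulfI (negbT (signr_eq0 int n))).
rewrite eqA exprM; set t := (-1) ^+ n.
(* The signs from G and C^(l+2) combine to t^(2l+3) = t, which cancels det C. *)
have tt : t ^+ l.+1 * t ^+ l.+2 = t.
  by rewrite -exprD addnS addnn -mul2n exprS exprM /t sqrr_sign expr1n mulr1.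
by rewrite -[in RHS]tt; ring.
Qed.

End Factorisation.

Theorem mainTheorem1 (k l : nat) (hk : (2 <= k)%N) (hl : (2 <= l)%N) :
  let case1 := (exists alpha : int, l%:Z - 1 = alpha * k%:Z)
               /\ gcdn l (k - 1) = 1%N in
  let case2 := (exists beta : int, l%:Z - 2%:Z = beta * k%:Z)
               /\ gcdn l (k - 1) = 1%N in
  [/\ case1 ->
        \det (Atilde0 k l) = (-1) ^+ ((k + l) * (k + l - 1) %/ 2 + 1),
      case2 ->
        \det (Atilde0 k l) = (-1) ^+ ((k + l) * (k + l - 1) %/ 2)
    & ~ case1 -> ~ case2 -> \det (Atilde0 k l) = 0].
Proof.
case: k l hk hl => [|[|k]] [|[|l]] // _ _; rewrite subn1 /=.
have dvdE (m : nat) (x : int) : x = m%:Z ->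
    (exists a : int, x = a * k.+2%:Z) <-> (k.+2 %| m)%N.
  move=> ->; split=> [[a e]|/dvdnP[q ->]]; last by exists q%:Z; rewrite PoszM.
  by have /dvdzP : exists q, m%:Z = q * k.+2%:Z by exists a.
have d1 := @dvdE l.+1 (l.+2%:Z - 1) ltac:(lia).
have d2 := @dvdE l (l.+2%:Z - 2%:Z) ltac:(lia).
have -> : ((k.+2 + l.+2) * (k.+2 + l.+2 - 1) %/ 2)%N = 'C((k + l.+2).+2, 2).
  by rewrite bin2 divn2 subn1 !addSn.
(* The exponent in the statement differs from C(n,2) by the odd number 2n+1, so the extra 1 belongs
   to the case l-1, where y_0 = 1. *)
have -> : 'C((k + l.+2).+2, 2) = (('C(k + l.+2, 2) + (k + l.+2).*2).+1)%N.
  by rewrite !binS !bin1 bin0 -addnn; lia.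
rewrite addn1 !exprS !mulN1r opprK exprD -mul2n exprM sqrrN !expr1n mulr1.
(* Consecutive integers are not both divisible by k+2 >= 2, so the two indicators in y_0 never
   cancel each other. *)
have dvd_contra : (k.+2 %| l.+1)%N -> (k.+2 %| l)%N -> False.
  by move=> h1 h2; move: h1; rewrite -[l.+1]addn1 dvdn_addr // dvdn1.
rewrite det_Atilde0 /coprime; split=> [[/d1 h1 ->]|[/d2 h2 ->]|n1 n2].
- case: (boolP (k.+2 %| l)%N) => [/(dvd_contra h1)//|_].
  by rewrite h1 eqxx subr0 !mul1r.
- case: (boolP (k.+2 %| l.+1)%N) => [/dvd_contra/(_ h2)//|_].
  by rewrite h2 eqxx sub0r mul1r mulN1r.
have [g1|_] := eqVneq; last by rewrite !mul0r.
case: (boolP (k.+2 %| l.+1)%N) => [/d1 h1|_]; first by case: n1.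
case: (boolP (k.+2 %| l)%N) => [/d2 h2|_]; first by case: n2.
by rewrite subrr mulr0 mul0r.
Qed.
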